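(* Let $m,n$ be positive integers with $m\geq 2$. Then for every integer $k$ with $1\leq k\leq n$, $$E(mn,k)=\sum_{\substack{p+q=n\\ p,q\geq 0}}(-1)^{p-k}\binom{p}{k}\zeta(\{m\}^p)\,\zeta^\star(\{m\}^q).$$
   Context: For positive integers $\alpha_1,\ldots,\alpha_r$ with $\alpha_r\geq 2$, the multiple zeta value is $\zeta(\alpha_1,\ldots,\alpha_r)=\sum_{1\leq k_1<k_2<\cdots<k_r}k_1^{-\alpha_1}\cdots k_r^{-\alpha_r}$ and the multiple zeta-star value is $\zeta^\star(\alpha_1,\ldots,\alpha_r)=\sum_{1\leq k_1\leq k_2\leq\cdots\leq k_r}k_1^{-\alpha_1}\cdots k_r^{-\alpha_r}$. $\{a\}^p$ denotes $p$ repetitions of $a$, and by convention $\zeta(\{m\}^0)=\zeta^\star(\{m\}^0)=1$. For $m\geq 2$ and $1\leq k\leq n$, $E(mn,k)=\sum\zeta(m\alpha_1,m\alpha_2,\ldots,m\alpha_k)$, the sum over all $k$-tuples $(\alpha_1,\ldots,\alpha_k)$ of positive integers with $\alpha_1+\cdots+\alpha_k=n$. The binomial coefficient $\binom{p}{k}$ is $0$ when $p<k$. *)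

(* Defs.v *)
From HB Require Import structures.
From mathcomp Require Import all_boot all_order all_algebra.
From mathcomp Require Import all_classical all_reals all_analysis.

Set Implicit Arguments.
Unset Strict Implicit.
Unset Printing Implicit Defensive.

Import Order.TTheory GRing.Theory Num.Theory.

Local Open Scope classical_set_scope.
Local Open Scope ring_scope.
Local Open Scope ereal_scope.

(* [mzs R lt a] is the sum, over the tuples 1 <= k_1, ..., 1 <= k_r of integers
   that are monotone for [lt], of k_1 ^ - a_1 * ... * k_r ^ - a_r, where r is
   the size of [a].  The terms are positive, so the sum is taken unordered in
   the extended reals: a divergent sum has value +oo, not a default real. *)
Definition mzs (R : realType) (lt : rel nat) (a : seq nat) : \bar R :=
  \esum_(k in [set k : (size a).-tuple nat | all (leq 1) k && sorted lt k])
    (\prod_(i < size a) (tnth k i)%:R ^- nth 0%N a i)%:E.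

Definition mzv (R : realType) (a : seq nat) : \bar R := mzs R ltn a.

Definition mzsv (R : realType) (a : seq nat) : \bar R := mzs R leq a.

(* E(mn, k); a positive integer that occurs in a composition of n is at most n,
   so the compositions are taken among the tuples over 'I_n.+1. *)
Definition mzvE (R : realType) (m n k : nat) : \bar R :=
  \sum_(a : k.-tuple 'I_n.+1 |
          [forall i, (0 < tnth a i)%N] && (\sum_(i < k) tnth a i == n)%N)
    mzv R [seq (m * val x)%N | x <- a].

(* For the empty tuple of exponents there is exactly one (empty) tuple of
   indices, so the conventions zeta({m}^0) = zeta*({m}^0) = 1 hold. *)
Lemma mzs_nil (R : realType) (lt : rel nat) : mzs R lt [::] = 1.
Proof.
rewrite /mzs (_ : [set _ | _] = [set [tuple]]); last first.
  by apply/seteqP; split=> k /=; rewrite tuple0.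
by rewrite esum_set1 big_ord0 // lee_fin.
Qed.

(* Main.v *)
(* Put x_j = j^-m and replace every sum by its tail, in which all indices are at
   least j. Splitting off the index j gives, for the tails e_p(j), h_q(j) of
   zeta({m}^p), zeta*({m}^q),
     e_(p+1)(j) = e_(p+1)(j+1) + x_j e_p(j+1),
     h_(q+1)(j) = h_(q+1)(j+1) + x_j h_q(j).
   Both sides F of the claimed identity, taken as tails, then satisfy
     F_(n+1,k)(j) - x_j F_(n,k)(j)
       = F_(n+1,k)(j+1) - x_j F_(n,k)(j+1) + x_j F_(n,k-1)(j+1),
   which is the factor
     1 + t x_j u / (1 - x_j u) = (1 + (t-1) x_j u) / (1 - x_j u)
   of the generating function in t^k u^n. By induction on n, the difference of
   the two sides does not depend on j, and it tends to 0 with the tails. *)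
Require Import Defs.
From HB Require Import structures.
From mathcomp Require Import all_boot all_order all_algebra.
From mathcomp Require Import all_classical all_reals all_analysis.
From mathcomp Require Import zify ring.

Set Implicit Arguments.
Unset Strict Implicit.
Unset Printing Implicit Defensive.

Import Order.TTheory GRing.Theory Num.Theory.
Import numFieldNormedType.Exports.

Local Open Scope classical_set_scope.
Local Open Scope ring_scope.
Local Open Scope ereal_scope.

(** * Tails of multiple zeta and zeta-star sums *)

Lemma esumZl (R : realType) (T : choiceType) (I : set T) (r : R)
    (a : T -> \bar R) : (0 <= r)%R -> (forall i, 0 <= a i) ->
  \esum_(i in I) (r%:E * a i) = r%:E * \esum_(i in I) a i.
Proof.
move=> r0 a0; rewrite /esum -ereal_supZl//; last first.
  by apply/set0P; exists (\sum_(i \in set0) a i), set0 => //; exact: fsets_set0.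
congr ereal_sup; apply/seteqP; split=> x /=.
  move=> [A sA <-]; exists (\sum_(i \in A) a i); first by exists A.
  by rewrite ge0_mule_fsumr.
by move=> [_ [A sA <-] <-]; exists A => //; rewrite ge0_mule_fsumr.
Qed.

(* [b] says whether the chains of indices are strict. *)
Definition mzs_rel (b : bool) : rel nat := if b then (ltn : rel nat) else leq.

(** At [j = 1] this unfolds to [mzv] when [b] is true and to [mzsv] when [b] is false. *)
Definition mzs_tail (R : realType) (b : bool) (a : seq nat) (j : nat) :
    \bar R :=
  \esum_(k in [set k : (size a).-tuple nat |
      all (leq j) k && sorted (mzs_rel b) k])
    (\prod_(i < size a) (tnth k i)%:R ^- nth 0%N a i)%:E.

Lemma mzs_rel_trans b : transitive (mzs_rel b).
Proof. by case: b; [exact: ltn_trans | exact: leq_trans]. Qed.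

(** With [b] read as 0 or 1, [b + x] is the least index that may follow [x]: [x + 1] in a strict
    chain, [x] in a weak one. *)
Lemma all_sorted_cons b j x (t : seq nat) :
  all (leq j) (x :: t) && sorted (mzs_rel b) (x :: t) =
  (j <= x)%N && (all (leq (b + x)) t && sorted (mzs_rel b) t).
Proof.
rewrite /= (path_sortedE (@mzs_rel_trans b)).
have -> : all (mzs_rel b x) t = all (leq (b + x)) t by case: b.
case: (leqP j x) => //= jx; apply/idP/idP; first by case/andP.
move=> /andP[xt ->]; rewrite xt !andbT; apply: sub_all xt => y.
by apply: leq_trans; rewrite (leq_trans jx)// leq_addl.
Qed.

Lemma prodV_ge0 (R : realType) n (x : 'I_n -> nat) (e : 'I_n -> nat) :
  0 <= (\prod_(i < n) (x i)%:R ^- e i : R)%:E.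
Proof.
by rewrite lee_fin; apply: prodr_ge0 => i _; rewrite invr_ge0 exprn_ge0.
Qed.

Lemma mzs_tail_ge0 (R : realType) b a j : 0 <= mzs_tail R b a j.
Proof. by apply: esum_ge0 => k _; exact: prodV_ge0. Qed.

Lemma mzs_tail_nil (R : realType) b j : mzs_tail R b [::] j = 1.
Proof.
rewrite /mzs_tail (_ : [set _ | _] = [set [tuple]]); last first.
  by apply/seteqP; split=> k /=; rewrite tuple0.
by rewrite esum_set1 big_ord0 // lee_fin.
Qed.

(** Splits off the smallest index [x]. All terms are nonnegative, so the sums may be nested in the
    extended reals without any convergence assumption. *)
Lemma mzs_tail_cons (R : realType) b a0 a j :
  mzs_tail R b (a0 :: a) j =
  \sum_(j <= x <oo) (x%:R ^- a0)%:E * mzs_tail R b a (b + x).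
Proof.
rewrite eseries_cond nneseries_esum; last first.
  by move=> x _; rewrite mule_ge0 ?mzs_tail_ge0// lee_fin invr_ge0 exprn_ge0.
under eq_esum => x _.
  rewrite /mzs_tail -esumZl; [|by rewrite invr_ge0 exprn_ge0|
    by move=> ?; exact: prodV_ge0].
  over.
rewrite esum_esum; last first.
  move=> x k _ _; apply: mule_ge0; last exact: prodV_ge0.
  by rewrite lee_fin invr_ge0 exprn_ge0.
rewrite /mzs_tail.
rewrite (reindex_esum ([set x | (j <= x)%N] `*`` (fun x =>
    [set k : (size a).-tuple nat |
      all (leq (b + x)) k && sorted (mzs_rel b) k]))
  _ (fun u => [tuple of u.1 :: u.2])).
  apply: eq_esum => -[x k] _ /=; rewrite -EFinM big_ord_recl tnth0 /=.
  by congr (_ * _)%:E; apply: eq_bigr => i _; rewrite tnthS.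
split.
- by move=> [x k] [/= jx xk]; rewrite all_sorted_cons jx.
- move=> [x k] [y l] _ _ /(congr1 val) /= [-> kl].
  by congr pair; exact: val_inj.
- move=> k /=; rewrite (tuple_eta k) all_sorted_cons => /andP[jk kk].
  by exists (thead k, behead_tuple k).
Qed.

Lemma le_mzs_tail (R : realType) b a i j : (i <= j)%N ->
  mzs_tail R b a j <= mzs_tail R b a i.
Proof.
move=> ij; apply: ereal_sup_le => _ [A [fA sA] <-]; exists A => //; split=> //.
move=> k /sA /= /andP[kj ->]; rewrite andbT; apply: sub_all kj => y.
exact: leq_trans.
Qed.

Lemma sum_invr_sqr_le2 (R : realType) n :
  (\sum_(0 <= k < n) (k%:R ^- 2 : R) <= 2)%R.
Proof.
(* 1 / (m + 1) bounds the terms of index larger than m + 1. *)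
suff H m : (\sum_(0 <= k < m.+2) (k%:R ^- 2 : R) + m.+1%:R^-1 <= 2)%R.
  apply: (@le_trans _ _ (\sum_(0 <= k < n.+2) k%:R ^- 2)%R).
    by rewrite !big_nat_recr//= -addrA lerDl addr_ge0// invr_ge0 exprn_ge0.
  by rewrite (le_trans _ (H n))// lerDl invr_ge0.
elim: m => [|m IH].
  by rewrite big_nat_recr// big_nat1 expr0n/= invr0 add0r expr1n invr1.
rewrite big_nat_recr//= (le_trans _ IH)// -addrA lerD2l.
set x : R := m.+1%:R; have x0 : (0 < x)%R by rewrite ltr0n.
rewrite -[m.+2]addn1 natrD -/x expr2.
(* The last summand is the gap [1/x - 1/(x+1) - 1/(x+1)^2], visibly nonnegative in this form. *)
have -> : (x^-1 = ((x + 1) * (x + 1))^-1 + (x + 1)^-1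
    + (x * (x + 1) * (x + 1))^-1)%R.
  by field; rewrite !gt_eqF//= ltr_wpDl.
by rewrite lerDl invr_ge0 !mulr_ge0// addr_ge0// ltW.
Qed.

(** Decouples the inner tail from the outer index, leaving a constant multiple of [x^-2]. *)
Lemma mzs_term_le (R : realType) b a0 a x : (2 <= a0)%N ->
  (x%:R ^- a0)%:E * mzs_tail R b a (b + x) <= (x%:R ^- 2)%:E * mzs_tail R b a 1.
Proof.
move=> a2; case: x => [|x].
  (* The index 0 contributes nothing, because the inverse of 0 is 0. *)
  by rewrite !expr0n (gtn_eqF (ltnW a2)) invr0 !mul0e.
apply: lee_pmul; rewrite ?mzs_tail_ge0 ?lee_fin ?invr_ge0 ?exprn_ge0//.
  rewrite lef_pV2 ?posrE ?exprn_gt0 ?ltr0n//.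
  by apply: ler_weXn2l => //; rewrite ler1n.
by apply: le_mzs_tail; rewrite addnS.
Qed.

Lemma mzs_series_ge0 (R : realType) b a0 a x :
  0 <= (x%:R ^- a0)%:E * mzs_tail R b a (b + x).
Proof. by rewrite mule_ge0 ?mzs_tail_ge0// lee_fin invr_ge0 exprn_ge0. Qed.

Lemma mzs_tail_cons_lty (R : realType) b a0 a : (2 <= a0)%N ->
  mzs_tail R b a 1 < +oo -> mzs_tail R b (a0 :: a) 0 < +oo.
Proof.
move=> a2 afin; have aE : mzs_tail R b a 1 = (fine (mzs_tail R b a 1))%:E.
  by rewrite fineK// ge0_fin_numE ?mzs_tail_ge0.
rewrite mzs_tail_cons.
apply: (@le_lt_trans _ _ (2%:E * mzs_tail R b a 1)); last first.
  by rewrite aE -EFinM ltry.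
have s2 : \sum_(0 <= x <oo) (x%:R ^- 2)%:E <= (2 : R)%:E.
  apply: lime_le.
    by apply: is_cvg_nneseries => x _ _; rewrite lee_fin invr_ge0 exprn_ge0.
  by apply: nearW => n; rewrite sumEFin lee_fin; exact: sum_invr_sqr_le2.
apply: (@le_trans _ _ (\sum_(0 <= x <oo) (x%:R ^- 2)%:E * mzs_tail R b a 1)).
  apply: lee_nneseries => x *; [exact: mzs_series_ge0 | exact: mzs_term_le].
under eq_eseriesr do rewrite muleC.
rewrite aE nneseriesZl; last by move=> x _; rewrite lee_fin invr_ge0 exprn_ge0.
by rewrite muleC lee_wpmul2r// lee_fin fine_ge0 ?mzs_tail_ge0.
Qed.

Lemma mzs_tail_lty (R : realType) b a j : all (leq 2) a ->
  mzs_tail R b a j < +oo.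
Proof.
elim: a j => [|a0 a IH] j /=; first by rewrite mzs_tail_nil ltry.
case/andP=> a2 aa; apply: (le_lt_trans (le_mzs_tail _ b _ (leq0n j))).
by apply: mzs_tail_cons_lty => //; exact: IH.
Qed.

Lemma mzs_tail_fin (R : realType) b a j : all (leq 2) a ->
  mzs_tail R b a j \is a fin_num.
Proof. by move=> aa; rewrite ge0_fin_numE ?mzs_tail_ge0 ?mzs_tail_lty. Qed.

(** Tails of a convergent series vanish in the limit; only the empty tuple of exponents keeps its
    constant value 1. *)
Lemma mzs_tail_cvg (R : realType) b a : all (leq 2) a ->
  fine (mzs_tail R b a j) @[j --> \oo] --> ((nilp a)%:R : R).
Proof.
case: a => [_|a0 a aa].
  by under eq_fun do rewrite mzs_tail_nil; exact: cvg_cst.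
apply: fine_cvg; rewrite (_ : mzs_tail R b (a0 :: a) =
  fun j => \sum_(j <= x <oo) (x%:R ^- a0)%:E * mzs_tail R b a (b + x)); last first.
  by apply/funext => j; exact: mzs_tail_cons.
apply: nneseries_tail_cvg => [|x _]; last exact: mzs_series_ge0.
by rewrite -mzs_tail_cons mzs_tail_lty.
Qed.

(** The single source of both splitting recursions: [b + j] is [j + 1] for the strict tails and [j]
    for the weak ones. *)
Lemma mzs_tail_consS (R : realType) b a0 a j : all (leq 2) (a0 :: a) ->
  fine (mzs_tail R b (a0 :: a) j) =
  (fine (mzs_tail R b (a0 :: a) j.+1)
   + j%:R ^- a0 * fine (mzs_tail R b a (b + j)))%R.
Proof.
move=> aa; have /andP[_ aa'] := aa.
have /esym := mzs_tail_cons R b a0 a j.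
rewrite (@nneseries_split _ _ j 1); last by move=> *; exact: mzs_series_ge0.
rewrite addn1 big_nat1 -mzs_tail_cons => <-.
rewrite fineD ?mzs_tail_fin// ?fineM ?mzs_tail_fin//; first by rewrite addrC.
by rewrite fin_numM ?mzs_tail_fin.
Qed.

Local Open Scope ring_scope.

(** * Sums over compositions *)

(* The sum of [f] over the compositions of [n] into [k] positive parts. *)
Fixpoint csum (V : nmodType) (f : seq nat -> V) (n k : nat) : V :=
  if k is k'.+1 then \sum_(a < n) csum (fun l => f (a.+1 :: l)) (n - a.+1) k'
  else if n is 0 then f [::] else 0.

Lemma eq_csum (V : nmodType) (f g : seq nat -> V) n k :
  (forall l, all (leq 1) l -> f l = g l) -> csum f n k = csum g n k.
Proof.
elim: k f g n => [|k IH] f g n fg /=; first by case: n => //; exact: fg.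
by apply: eq_bigr => a _; apply: IH => l l1; apply: fg.
Qed.

Lemma csum0 (V : nmodType) n k : csum (fun=> 0 : V) n k = 0.
Proof. by elim: k n => [|k IH] [|n] //=; rewrite big1. Qed.

Lemma csumDZ (R : pzRingType) (x : R) (f g : seq nat -> R) n k :
  csum (fun l => f l + x * g l) n k = csum f n k + x * csum g n k.
Proof.
elim: k f g n => [|k IH] f g n /=.
  by case: n => [|n] //; rewrite mulr0 addr0.
by rewrite mulr_sumr -big_split; apply: eq_bigr => a _; exact: IH.
Qed.

(** Links the tuples in [mzvE] to [csum]. The bound [B] is independent of [n] because removing the
    first part lowers [n] but not the type of the entries. *)
Lemma csum_tuple (V : nmodType) (f : seq nat -> V) (B n k : nat) : (n < B)%N ->
  \sum_(a : k.-tuple 'I_B | [forall i, (0 < tnth a i)%N] &&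
      (\sum_(i < k) tnth a i == n)%N) f [seq val x | x <- a] = csum f n k.
Proof.
elim: k f n => [|k IH] f n nB.
  rewrite (eq_bigl (fun a => (0%N == n) && (a == [tuple]))); last first.
    move=> a /=; rewrite big_ord0 (tuple0 a) [_ == [tuple]]eqxx andbT.
    have -> : [forall i, (0 < tnth ([tuple] : 0.-tuple 'I_B) i)%N].
      by apply/forallP => -[].
    by [].
  case: n nB => [|n] _ /=; last by rewrite big_pred0.
  by rewrite (big_pred1 [tuple]).
rewrite (reindex (fun u : 'I_B * k.-tuple 'I_B => [tuple of u.1 :: u.2])); last first.
  exists (fun t : k.+1.-tuple 'I_B => (thead t, behead_tuple t)).
    by case=> x t _; congr pair; apply/val_inj.
  by move=> t _; rewrite [RHS]tuple_eta; exact/val_inj.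
rewrite (eq_bigl (fun u : 'I_B * k.-tuple 'I_B => (0 < u.1 <= n)%N &&
    ([forall i, (0 < tnth u.2 i)%N] && (\sum_(i < k) tnth u.2 i == n - u.1)%N)));
  last first.
  move=> [x t] /=; rewrite big_ord_recl.
  set u : k.+1.-tuple 'I_B := [tuple of x :: t].
  have u0 : tnth u ord0 = x by [].
  have uS (i : 'I_k) : tnth u (lift ord0 i) = tnth t i by exact: tnthS.
  rewrite u0 [X in (x + X)%N](eq_bigr (fun i => val (tnth t i))); last first.
    by move=> i _; rewrite uS.
  have -> : [forall i, (0 < tnth u i)%N] =
      (0 < x)%N && [forall i, (0 < tnth t i)%N].
    apply/forallP/andP => [H|[x0 /forallP H] i].
      split; first by have := H ord0; rewrite u0.
      by apply/forallP => i; have := H (lift ord0 i); rewrite uS.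
    by case: (unliftP ord0 i) => [j|] ->; rewrite ?uS ?u0.
  rewrite -!andbA; congr (_ && _); rewrite andbCA; congr (_ && _).
  by case: leqP => /= xn; apply/eqP/eqP; lia.
rewrite -(pair_big_dep (fun x : 'I_B => (0 < x <= n)%N)
  (fun x (t : k.-tuple 'I_B) => [forall i, (0 < tnth t i)%N] &&
    (\sum_(i < k) tnth t i == n - x)%N)
  (fun x t => f [seq val y | y <- [tuple of x :: t]])) /=.
under eq_bigr => x xn.
  rewrite (IH (fun l => f (val x :: l)) (n - x)%N); last first.
    by rewrite (leq_ltn_trans _ nB)// leq_subr.
  over.
rewrite -(big_mkord (fun x => (0 < x <= n)%N)
  (fun x => csum (fun l => f (x :: l)) (n - x) k)).
case: B nB {IH} => // B nB.
(* The first part 0 is excluded; the others are written [a + 1] with [a < n]. *)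
rewrite big_ltn_cond//= big_add1/= -(big_mkord xpredT
  (fun a => csum (fun l => f (a.+1 :: l)) (n - a.+1) k)).
by rewrite (big_nat_widen 0 n B).
Qed.

(** * Recursions and limits of the two sides *)

(* The coefficient of t^k u^n in (sum_p e_p ((t-1) u)^p) (sum_q h_q u^q). *)
Definition alt_conv (R : pzRingType) (e h : nat -> R) (n k : nat) : R :=
  \sum_(p < n.+1) (-1) ^+ (p + k) * 'C(p, k)%:R * e p * h (n - p)%N.

Lemma alt_conv_rec (R : comPzRingType) (x : R) (e e' h h' : nat -> R) n k :
  e 0%N = e' 0%N -> (forall p, e p.+1 = e' p.+1 + x * e' p) ->
  h 0%N = h' 0%N -> (forall q, h q.+1 = h' q.+1 + x * h q) ->
  alt_conv e h n.+1 k + x * alt_conv e' h' n k =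
  alt_conv e' h' n.+1 k + x * alt_conv e h n k
    + x * (if k is k'.+1 then alt_conv e' h' n k' else 0).
Proof.
move=> e0 eS h0 hS.
set c := fun p k : nat => (-1) ^+ (p + k) * 'C(p, k)%:R : R.
(* The recursion of [h] is multiplication of its generating function by [1 - x u], which replaces
   [h] by [h']. *)
have E : alt_conv e h n.+1 k = \sum_(p < n.+2) c p k * e p * h' (n.+1 - p)%N
    + x * alt_conv e h n k.
  rewrite /alt_conv big_ord_recr [in RHS]big_ord_recr /= subnn h0 [RHS]addrAC.
  congr (_ + _); rewrite mulr_sumr -big_split; apply: eq_bigr => p _.
  by rewrite subSn -1?ltnS// hS /c /=; ring.
rewrite E [RHS]addrAC [LHS]addrAC; congr (_ + _).
have -> : \sum_(p < n.+2) c p k * e p * h' (n.+1 - p)%N =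
  alt_conv e' h' n.+1 k + x * \sum_(p < n.+1) c p.+1 k * e' p * h' (n - p)%N.
  rewrite /alt_conv !(big_ord_recl n.+1) /= e0 -addrA; congr (_ + _).
  rewrite mulr_sumr -big_split; apply: eq_bigr => p _ /=.
  by rewrite /bump /= !add1n subSS eS /c; ring.
rewrite -addrA; congr (_ + _); rewrite -mulrDr; congr (_ * _).
(* Pascal's rule with signs: [c (p+1) k + c p k = c p (k-1)], read as 0 for [k = 0]. *)
rewrite /alt_conv -big_split; case: k {E} @c => [|k] c /=.
  by apply: big1 => p _; rewrite /c !bin0 addSn exprS; ring.
apply: eq_bigr => p _; rewrite /c binS natrD !addSn !addnS !exprS; ring.
Qed.

(** The correction terms [x^a] over the first part [a] form a geometric sum: [a = 1] gives the term
    with one part fewer, and lowering the parts [a > 1] by one gives [x] times the correction for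
    [n]. *)
Lemma csum_rec (R : comPzRingType) (x : R) (f f' : seq nat -> R) n k :
  (forall a l, all (leq 1) (a :: l) -> f (a :: l) = f' (a :: l) + x ^+ a * f' l) ->
  f [::] = f' [::] ->
  csum f n.+1 k + x * csum f' n k = csum f' n.+1 k + x * csum f n k
    + x * (if k is k'.+1 then csum f' n k' else 0).
Proof.
move=> fS f0; case: k => [|k] /=.
  by case: n => [|n]; rewrite ?f0 ?mulr0 ?addr0 // add0r.
have F N : \sum_(a < N) csum (fun l => f (a.+1 :: l)) (N - a.+1) k =
    \sum_(a < N) csum (fun l => f' (a.+1 :: l)) (N - a.+1) k
    + \sum_(a < N) x ^+ a.+1 * csum f' (N - a.+1) k.
  rewrite -big_split; apply: eq_bigr => a _ /=; rewrite -csumDZ.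
  by apply: eq_csum => l l1; apply: fS.
rewrite !F [X in _ + X + _ = _]big_ord_recl /= subn1 /=.
under [X in _ + (_ + X) + _ = _]eq_bigr do rewrite /bump add1n subSS exprS -mulrA.
by rewrite -mulr_sumr; ring.
Qed.

Lemma cvg_csum (R : realType) (f : nat -> seq nat -> R) (g : seq nat -> R) n k :
  (forall l, all (leq 1) l -> f j l @[j --> \oo] --> g l) ->
  csum (f j) n k @[j --> \oo] --> csum g n k.
Proof.
elim: k f g n => [|k IH] f g n fg /=.
  by case: n => [|n]; [exact: fg | exact: cvg_cst].
apply: (cvg_big add_continuous) => a _.
by apply: (IH (fun j l => f j (a.+1 :: l))) => l l1; apply: fg.
Qed.

(** A composition of a positive integer has a part, so the limits of the tails all vanish on it. *)
Lemma csum_nilp (R : pzRingType) n k :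
  csum (fun l => (nilp l)%:R : R) n.+1 k = 0.
Proof. by case: k => // k; apply: big1 => a _; exact: csum0. Qed.

Lemma cvg_alt_conv (R : realType) (e h : nat -> nat -> R) (e' h' : nat -> R) n k :
  (forall p, e j p @[j --> \oo] --> e' p) ->
  (forall p, h j p @[j --> \oo] --> h' p) ->
  alt_conv (e j) (h j) n k @[j --> \oo] --> alt_conv e' h' n k.
Proof.
move=> ee hh; apply: (cvg_big add_continuous) => p _.
by apply: cvgM => //; apply: cvgM => //; exact: cvg_cst.
Qed.

(** The indices [p] and [n + 1 - p] cannot both be 0. *)
Lemma alt_conv_eq0 (R : pzRingType) n k :
  alt_conv (fun p => (p == 0%N)%:R) (fun q => (q == 0%N)%:R) n.+1 k = 0 :> R.
Proof.
apply: big1 => -[[|p] ?] _ /=; first by rewrite mulr0.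
by rewrite mulr0 mul0r.
Qed.

(** * The identity for tails, and the theorem *)

Lemma all_nseq_leq2 m p : (2 <= m)%N -> all (leq 2) (nseq p m).
Proof. by move=> m2; rewrite all_nseq m2 orbT. Qed.

Lemma all_map_leq2 m l : (2 <= m)%N -> all (leq 1) l ->
  all (leq 2) (map (muln m) l).
Proof.
move=> m2 l1; rewrite all_map; apply: sub_all l1 => a /= a1.
by rewrite (leq_trans m2)// leq_pmulr.
Qed.

(** All [j] and all [k], including 0, are treated at once: the recursion for [n + 1] calls on [n] at
    two consecutive cut-offs and also at [k - 1]. *)
Lemma csum_tail_eq_alt_conv (R : realType) m n k j : (2 <= m)%N ->
  csum (fun l => fine (mzs_tail R true (map (muln m) l) j)) n k =
  alt_conv (fun p => fine (mzs_tail R true (nseq p m) j))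
           (fun q => fine (mzs_tail R false (nseq q m) j)) n k.
Proof.
move=> m2.
set f := fun j l => fine (mzs_tail R true (map (muln m) l) j).
set e := fun j p => fine (mzs_tail R true (nseq p m) j).
set h := fun j q => fine (mzs_tail R false (nseq q m) j).
rewrite -/(f j) -/(e j) -/(h j).
have nil1 b i : fine (mzs_tail R b [::] i) = 1 by rewrite mzs_tail_nil.
elim: n k j => [|n IH] k j.
  rewrite /alt_conv big_ord1 subnn /e /h !nil1 !mulr1.
  case: k => [|k] /=; first by rewrite /f nil1 expr0 mul1r.
  by rewrite big_ord0 bin0n mulr0.
have step i : csum (f i) n.+1 k - alt_conv (e i) (h i) n.+1 k =
    csum (f i.+1) n.+1 k - alt_conv (e i.+1) (h i.+1) n.+1 k.
  (* Here [x = i^-m], so an exponent [m * a] contributes [x^a]. *)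
  have M1 : forall a l, all (leq 1) (a :: l) ->
      f i (a :: l) = f i.+1 (a :: l) + (i%:R ^- m) ^+ a * f i.+1 l.
    move=> a l al; rewrite /f mzs_tail_consS; last exact: (all_map_leq2 m2 al).
    by rewrite add1n exprM exprVn.
  have E1 p : e i p.+1 = e i.+1 p.+1 + i%:R ^- m * e i.+1 p.
    by rewrite /e mzs_tail_consS ?add1n//; exact: (all_nseq_leq2 p.+1).
  have H1 p : h i p.+1 = h i.+1 p.+1 + i%:R ^- m * h i p.
    by rewrite /h mzs_tail_consS ?add0n//; exact: (all_nseq_leq2 p.+1).
  have fnil : f i [::] = f i.+1 [::] by rewrite /f !nil1.
  have e0 : e i 0%N = e i.+1 0%N by rewrite /e !nil1.
  have h0 : h i 0%N = h i.+1 0%N by rewrite /h !nil1.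
  have := csum_rec n k M1 fnil; have := alt_conv_rec n k e0 E1 h0 H1.
  (* By induction the terms of weight [n] agree in the two recursions, so they cancel in the
     difference. *)
  rewrite !IH; have -> : (if k is k'.+1 then csum (f i.+1) n k' else 0) =
      (if k is k'.+1 then alt_conv (e i.+1) (h i.+1) n k' else 0).
    by case: (k) => // k'; rewrite IH.
  set u := _ * (if _ is _.+1 then _ else _).
  set v := _ * alt_conv (e i.+1) _ _ _; set w := _ * alt_conv (e i) _ _ _.
  move=> E M; rewrite -(addrKA v) (addrC v) M E.
  by rewrite -!(addrA _ w u) [X in _ - X]addrC addrKA.
apply/eqP; rewrite -subr_eq0; apply/eqP.
set d := fun i => csum (f i) n.+1 k - alt_conv (e i) (h i) n.+1 k.
have dE i : d (i + j)%N = d j.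
  by elim: i => // i <-; rewrite addSn /d -step.
have d0 : d i @[i --> \oo] --> (0 : R).
  rewrite -(subr0 0); rewrite -{1}(csum_nilp R n k) -(alt_conv_eq0 R n k).
  apply: cvgB.
    apply: cvg_csum => l l1.
    rewrite (_ : nilp l = nilp (map (muln m) l)); last by case: l {l1}.
    by apply: mzs_tail_cvg; exact: all_map_leq2.
  apply: cvg_alt_conv => p.
    have := @mzs_tail_cvg R true (nseq p m) (all_nseq_leq2 p m2).
    by rewrite /nilp size_nseq.
  have := @mzs_tail_cvg R false (nseq p m) (all_nseq_leq2 p m2).
  by rewrite /nilp size_nseq.
(* Being constant from [j] on, [d] also converges to [d j], which must then be 0. *)
have dj : d i @[i --> \oo] --> d j.
  rewrite -(cvg_shiftn j) (_ : (fun _ => _) = cst (d j)).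
    exact: cvg_cst.
  exact/funext.
exact: (cvg_unique _ dj d0).
Qed.

Local Open Scope ereal_scope.

Theorem theoremA (R : realType) (m n : nat) (hm : (2 <= m)%N) (hn : (0 < n)%N)
    (k : nat) (hk1 : (1 <= k)%N) (hkn : (k <= n)%N) :
  mzvE R m n k =
  \sum_(p < n.+1)
    ((-1 : R) ^ (p%:Z - k%:Z) * 'C(p, k)%:R)%:E
      * mzv R (nseq p m) * mzsv R (nseq (n - p) m).
Proof.
(* All exponents are at least 2, so every value is finite and the claim can be proved in the
   reals. *)
pose G b a := fine (mzs_tail R b a 1).
have mzvG a : all (leq 2) a -> mzv R a = (G true a)%:E.
  by move=> aa; rewrite /G fineK ?mzs_tail_fin.
have mzsvG a : all (leq 2) a -> mzsv R a = (G false a)%:E.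
  by move=> aa; rewrite /G fineK ?mzs_tail_fin.
have -> : mzvE R m n k = (csum (fun l => G true (map (muln m) l)) n k)%:E.
  rewrite -(@csum_tuple _ _ n.+1)// -sumEFin.
  apply: eq_bigr => a /andP[/forallP a0 _].
  rewrite -map_comp mzvG// map_comp; apply: (all_map_leq2 hm).
  by rewrite all_map; apply/allP => _ /tnthP[i ->]; exact: a0.
rewrite csum_tail_eq_alt_conv// -sumEFin; apply: eq_bigr => p _.
rewrite mzvG ?mzsvG ?all_nseq_leq2// -!EFinM; congr (_ * _ * _)%:E.
(* For [p < k] the binomial coefficient kills the negative power of -1; otherwise [p - k] and
   [p + k] have the same parity. *)
case: (leqP k p) => kp; last by rewrite bin_small// !mulr0.
congr (_ * _)%R; rewrite subzn// -exprnP -signr_odd -[RHS]signr_odd.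
by rewrite oddB// oddD.
Qed.
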